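(* Let $k\ge 2$ be an integer. For any $(u,v)\in\Delta_k$ and $t\in\delta_k$, $$\mathbb{P}[X_k(u,v)=t]=\frac{(ku)!\,(kv)!\,(k(1-u))!\,(k(1-v))!}{k!\,(k(u-t))!\,(k(v-t))!\,(k(1-u-v+t))!\,(kt)!},$$ where $\tfrac{1}{m!}$ is interpreted as $0$ whenever $m$ is a negative integer.
   Context: Fix an integer $k\ge 2$. Let $[k]=\{1,\dots,k\}$, $\delta_k=\{0,\tfrac1k,\dots,\tfrac{k-1}{k},1\}$ and $\Delta_k=\delta_k\times\delta_k$. Let $\mathcal{S}_k$ be the set of all permutations of $[k]$. For $\pi\in\mathcal{S}_k$, let $C_\pi\colon\Delta_k\to[0,1]$ be the discrete copula with mass $\tfrac1k$ in each square $[\tfrac{i-1}{k},\tfrac ik]\times[\tfrac{\pi(i)-1}{k},\tfrac{\pi(i)}{k}]$, $i\in[k]$, and mass $0$ in all other squares of the mesh; that is, $C_\pi(\tfrac ik,\tfrac jk)=\tfrac1k\,|\{m\in[k] : m\le i,\ \pi(m)\le j\}|$ for $i,j\in\{0,1,\dots,k\}$. The random discrete copula induced by a permutation, $X_k$, is the random field over $\Delta_k$ given by $X_k(u,v)=C_\pi(u,v)$, where $\pi$ is chosen uniformly at random from $\mathcal{S}_k$ (equivalently, $C_\pi$ is chosen uniformly at random from $\{C_\pi:\pi\in\mathcal{S}_k\}$). *)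

(* Defs.v *)
From HB Require Import structures.
From mathcomp Require Export all_boot all_order all_fingroup all_algebra.
From mathcomp Require Export all_classical all_reals all_analysis.

Set Implicit Arguments.
Unset Strict Implicit.
Unset Printing Implicit Defensive.

Import Order.TTheory GRing.Theory Num.Theory.

Local Open Scope ring_scope.

Definition delta (R : realType) (k : nat) : seq R :=
  [seq i%:R / k%:R | i <- iota 0 k.+1].

(* C_pi(u, v) = (1/k) |{m in [k] : m <= k u, pi(m) <= k v}|.  The elements of
   'I_k are 0, ..., k - 1, hence the successors.  The formula makes sense for
   all reals, but C_pi is only meant on the mesh: see discrete_copulaE. *)
Definition discrete_copula (R : realType) (k : nat) (s : 'S_k) (u v : R) : R :=
  #|[pred m : 'I_k |
      (m.+1%:R <= k%:R * u) && ((s m).+1%:R <= k%:R * v)]|%:R / k%:R.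

Lemma discrete_copulaE (R : realType) (k : nat) (s : 'S_k) (i j : nat) :
  (0 < k)%N ->
  discrete_copula s (i%:R / k%:R) (j%:R / k%:R) =
  k%:R^-1 * #|[pred m : 'I_k | (m.+1 <= i)%N && ((s m).+1 <= j)%N]|%:R :> R.
Proof.
move=> k0; rewrite /discrete_copula mulrC; congr (_ * _%:R).
have kn0 : k%:R != 0 :> R by rewrite pnatr_eq0 -lt0n.
by apply: eq_card => m; rewrite !inE ![k%:R * _]mulrC !divfK // !ler_nat.
Qed.

(* Measurability of the preimages of points is measurability for the discrete
   sigma-algebra, since 'S_k is finite. *)
Definition uniform_permutation (R : realType) (d : measure_display)
    (Omega : measurableType d) (P : probability Omega R) (k : nat)
    (pi : Omega -> 'S_k) : Prop :=
  forall s : 'S_k,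
    measurable (pi @^-1` [set s])%classic /\
    P (pi @^-1` [set s])%classic = ((k`!)%:R^-1)%:E.

Definition random_discrete_copula (R : realType) (Omega : Type) (k : nat)
    (pi : Omega -> 'S_k) (u v : R) : Omega -> R :=
  fun omega => discrete_copula (pi omega) u v.

(* x! and 1/x! for a real x whose value is an integer; x! is used for x >= 0,
   and 1/x! is 0 for x < 0. *)
Definition factr (R : realType) (x : R) : R := ((Num.truncn x)`!)%:R.

Definition invfactr (R : realType) (x : R) : R :=
  if x < 0 then 0 else (factr x)^-1.

Lemma factr_nat (R : realType) (n : nat) : factr n%:R = (n`!)%:R :> R.
Proof. by rewrite /factr natrK. Qed.

Lemma invfactr_int (R : realType) (m : int) :
  invfactr m%:~R = (if m is Posz n then (n`!)%:R^-1 else 0) :> R.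
Proof.
rewrite /invfactr ltrz0; case: m => n /=; last by [].
by rewrite -pmulrn factr_nat.
Qed.

(* Main.v *)
(* With u = i/k, v = j/k, t = l/k, A = {0, .., i - 1} and B = {0, .., j - 1},
   the event says that s(A) meets B in exactly l points.  The image s(A) is
   equidistributed over the i-subsets of [k], each arising from i! (k - i)!
   permutations, and 'C(j, l) 'C(k - j, i - l) of these subsets meet B in l
   points: the law is hypergeometric. *)
Require Import Defs.
From mathcomp Require Import ring zify.

Set Implicit Arguments.
Unset Strict Implicit.
Unset Printing Implicit Defensive.

Import Order.TTheory GRing.Theory Num.Theory.

Section PermutationCount.
Variable T : finType.
Implicit Types A B C : {set T}.
Local Open Scope nat_scope.

(** List [T] with [A] first and its complement after, and likewise with [C] first. Matching equal
    positions gives a permutation, and the initial blocks correspond because they have the same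
    length. *)
Lemma exists_perm_imset A C :
  #|A| = #|C| -> exists s : {perm T}, [set s x | x in A] = C.
Proof.
move=> eqAC.
pose enumC (X : {set T}) := enum X ++ enum (~: X).
have mem_enumC X x : x \in enumC X.
  by rewrite mem_cat !mem_enum inE orbN.
have uniq_enumC X : uniq (enumC X).
  rewrite cat_uniq !enum_uniq /= andbT; apply/hasPn => x.
  by rewrite !mem_enum inE.
have size_enumC X : size (enumC X) = #|T|.
  by rewrite size_cat -!cardE cardsC.
pose f x := nth x (enumC C) (index x (enumC A)).
have idx x : index x (enumC A) < size (enumC C).
  by rewrite size_enumC -(size_enumC A) index_mem.
have inj_f : injective f.
  (* By [idx] the default of [nth] is never reached, so the defaults [x] and [y] may be
     identified. *)
  move=> x y /eqP; rewrite /f (set_nth_default y x (idx x)).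
  rewrite nth_uniq // => /eqP eq_idx.
  by rewrite -(nth_index y (mem_enumC A x)) eq_idx nth_index.
exists (perm inj_f); apply/eqP.
rewrite eqEcard card_imset; last exact: perm_inj.
rewrite eqAC leqnn andbT.
apply/fintype.subsetP => _ /imsetP[x xA ->].
rewrite permE /f nth_cat index_cat mem_enum xA.
have lt_idx : index x (enum A) < size (enum C).
  by rewrite -cardE -eqAC cardE index_mem mem_enum.
by rewrite lt_idx -mem_enum mem_nth.
Qed.

(** The count [N C] depends only on the size of [C], so the [#|T|]! permutations split evenly among
    the ['C(#|T|, #|A|)] possible images. *)
Lemma card_perm_imset_eq A C :
  #|A| = #|C| ->
  #|[set s : {perm T} | [set s x | x in A] == C]| = (#|A|)`! * (#|~: A|)`!.
Proof.
move=> eqAC; pose N C := #|[set s : {perm T} | [set s x | x in A] == C]|.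
(* Following [s] by a fixed [r] that carries [C1] to [C2] is injective; exchanging [C1] and [C2]
   then yields equality. *)
have le_N C1 C2 : #|C1| = #|C2| -> N C1 <= N C2.
  move=> /exists_perm_imset[r <-].
  rewrite /N -(card_imset _ (mulIg r)); apply: subset_leq_card.
  apply/fintype.subsetP => _ /imsetP[s + ->]; rewrite !inE => /eqP <-.
  rewrite -imset_comp; apply/eqP/eq_imset => x /=; exact: permM.
have eq_N C1 : #|C1| = #|A| -> N C1 = N C.
  by move=> eqC1; apply/eqP; rewrite eqn_leq !le_N // eqC1.
have total : 'C(#|T|, #|A|) * N C = (#|T|)`!.
  have <- : #|{perm T}| = (#|T|)`!.
    rewrite -cardsT -card_perm; apply: eq_card => s.
    by rewrite unfold_in; apply/esym/fintype.subsetP => x; rewrite !inE.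
  rewrite -card_draws -sum_nat_const -[RHS]sum1_card.
  rewrite (partition_big (fun s : {perm T} => [set s x | x in A])
    [in [set D : {set T} | #|D| == #|A|]]) /=; last first.
    by move=> s _; rewrite inE card_imset //; exact: perm_inj.
  apply: eq_bigr => D; rewrite inE => /eqP /eq_N <-.
  by rewrite /N -sum1_card; apply: eq_bigl => s; rewrite inE.
apply/eqP; rewrite -(eqn_pmul2l (m := 'C(#|T|, #|A|))) ?bin_gt0 ?max_card //.
by rewrite total (cardsCs (~: A)) finset.setCK bin_fact ?max_card.
Qed.

(** The map from [C] to [(C :&: B, C :\: B)] is a bijection onto pairs of a subset of [B] and a
    subset of [~: B]. *)
Lemma card_setI_setD B l m :
  #|[set C : {set T} | (#|C :&: B| == l) && (#|C :\: B| == m)]| =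
  'C(#|B|, l) * 'C(#|~: B|, m).
Proof.
rewrite -!cards_draws -cardsX.
pose f (C : {set T}) := (C :&: B, C :\: B).
have inj_f : injective f.
  by move=> C D [eqI eqD]; rewrite -(setID C B) eqI eqD setID.
rewrite -(card_imset _ inj_f); apply: eq_card => -[C D]; rewrite !inE /=.
apply/imsetP/idP => [[E + [-> ->]]|].
  rewrite inE => /andP[-> ->]; rewrite finset.subsetIr /= andbT.
  by rewrite finset.setDE finset.subsetIr.
case/andP => /andP[sCB cC] /andP[sDB cD].
have eqI : (C :|: D) :&: B = C.
  apply/setP => x; rewrite !inE; move/fintype.subsetP/(_ x)/implyP: sCB.
  move/fintype.subsetP/(_ x)/implyP: sDB; rewrite inE.
  by case: (x \in C) (x \in D) (x \in B) => [] [] [].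
have eqD : (C :|: D) :\: B = D.
  apply/setP => x; rewrite !inE; move/fintype.subsetP/(_ x)/implyP: sCB.
  move/fintype.subsetP/(_ x)/implyP: sDB; rewrite inE.
  by case: (x \in C) (x \in D) (x \in B) => [] [] [].
by exists (C :|: D); rewrite ?inE /f eqI eqD ?cC.
Qed.

(** Permutations are grouped by the image of [A]. The parameter [m] is the number of image points
    outside [B], which avoids truncated subtraction. *)
Lemma card_perm_imsetI A B l m :
  #|A| = l + m ->
  #|[set s : {perm T} | #|[set s x | x in A] :&: B| == l]| =
  (#|A|)`! * (#|~: A|)`! * ('C(#|B|, l) * 'C(#|~: B|, m)).
Proof.
move=> cA; rewrite -card_setI_setD mulnC -sum_nat_const -sum1_card.
rewrite (partition_big (fun s : {perm T} => [set s x | x in A])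
  [in [set C : {set T} | (#|C :&: B| == l) && (#|C :\: B| == m)]]) /=.
  apply: eq_bigr => C; rewrite inE => /andP[/eqP cI /eqP cD].
  have eqAC : #|A| = #|C| by rewrite cA -cI -cD cardsID.
  rewrite -(card_perm_imset_eq eqAC) -sum1_card; apply: eq_bigl => s.
  by rewrite !inE andb_idl // => /eqP ->; rewrite cI.
move=> s; rewrite !inE => /[dup] /eqP cI ->.
rewrite -(eqn_add2l l) -cA -{1}cI cardsID card_imset ?eqxx //; exact: perm_inj.
Qed.

End PermutationCount.

Local Open Scope ring_scope.

(** The event is a finite disjoint union of fibres of [pi], each measurable of mass 1/k!. *)
Lemma uniform_permutation_prob (R : realType) (d : measure_display)
    (Omega : measurableType d) (P : probability Omega R) (k : nat)
    (pi : Omega -> 'S_k) (Q : pred 'S_k) :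
  uniform_permutation P pi ->
  P [set omega | Q (pi omega)]%classic =
  (#|[set s | Q s]|%:R / (k`!)%:R)%:E.
Proof.
move=> hpi.
have -> : [set omega | Q (pi omega)]%classic =
    \big[setU/set0]_(s | Q s) (pi @^-1` [set s])%classic.
  rewrite -bigcup_pred; apply/seteqP; split=> w /=.
    by move=> Qw; exists (pi w).
  by case=> s Qs ->.
rewrite -bigcup_pred measure_fin_bigcup /=; last 3 first.
- exact: finite_finset.
- by move=> s1 s2 _ _ [w [/= <- <-]].
- by move=> s _; case: (hpi s).
rewrite (eq_fsbigr (fun=> ((k`!)%:R^-1)%:E)); last by move=> s _; case: (hpi s).
rewrite -(_ : [set` enum Q]%classic = [set` Q]%classic); last first.
  by apply/seteqP; split=> s /=; rewrite mem_enum.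
rewrite -fsbig_seq ?enum_uniq // sumEFin big_enum /= sumr_const.
by rewrite cardsE mulr_natl.
Qed.

Lemma invfactr_nat (R : realType) (n : nat) : invfactr n%:R = (n`!)%:R^-1 :> R.
Proof. exact: (invfactr_int R n). Qed.

(** Turns the convention for negative factorials into a case split on naturals. *)
Lemma invfactr_natB (R : realType) (m n : nat) :
  invfactr (m%:R - n%:R) = (if (n <= m)%N then ((m - n)`!)%:R^-1 else 0) :> R.
Proof.
rewrite /invfactr subr_lt0 ltr_nat; case: leqP => // le_nm.
by rewrite -natrB // factr_nat.
Qed.

Lemma card_ord_lt (k i : nat) : (i <= k)%N -> #|[set m : 'I_k | (m < i)%N]| = i.
Proof.
move=> le_ik; rewrite -sum1_card; under eq_bigl do rewrite inE.
by rewrite -(big_ord_widen _ (fun=> 1%N)) // sum1_card card_ord.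
Qed.

(** The injection [s] carries the points counted by the copula onto the intersection on the
    right. *)
Lemma discrete_copula_eq (R : realType) (k : nat) (s : 'S_k) (i j l : nat) :
  (0 < k)%N ->
  (discrete_copula s (i%:R / k%:R) (j%:R / k%:R) == l%:R / k%:R :> R) =
  (#|[set s m | m in [set m : 'I_k | (m < i)%N]] :&: [set m : 'I_k | (m < j)%N]|
    == l).
Proof.
move=> k_gt0; have k_neq0 : k%:R != 0 :> R by rewrite pnatr_eq0 -lt0n.
rewrite discrete_copulaE // mulrC (inj_eq (mulIf _)) ?invr_eq0 // eqr_nat.
rewrite -[in LHS](card_imset _ (@perm_inj _ s)); congr (_ == _).
apply: eq_card => m.
apply/imsetP/finset.setIP => [[n + ->]|[/imsetP[n + ->]]].
  by rewrite !inE => /andP[lt_i lt_j]; rewrite lt_j imset_f ?inE.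
by rewrite !inE => lt_i lt_j; exists n; rewrite ?inE ?lt_i.
Qed.

Theorem proposition3p2 (R : realType) (d : measure_display)
    (Omega : measurableType d) (P : probability Omega R)
    (k : nat) (hk : (2 <= k)%N)
    (pi : Omega -> 'S_k) (hpi : uniform_permutation P pi)
    (u v : R) (hu : u \in delta R k) (hv : v \in delta R k)
    (t : R) (ht : t \in delta R k) :
  P [set omega | random_discrete_copula pi u v omega = t]%classic =
  (factr (k%:R * u) * factr (k%:R * v) *
   factr (k%:R * (1 - u)) * factr (k%:R * (1 - v)) *
   (invfactr (k%:R) * invfactr (k%:R * (u - t)) * invfactr (k%:R * (v - t)) *
    invfactr (k%:R * (1 - u - v + t)) * invfactr (k%:R * t)))%:E.
Proof.
have k_gt0 : (0 < k)%N by exact: ltn_trans hk.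
have k_neq0 : k%:R != 0 :> R by rewrite pnatr_eq0 -lt0n.
have deltaP x : x \in delta R k -> exists2 i, (i <= k)%N & x = i%:R / k%:R.
  by case/mapP => i; rewrite mem_iota add0n ltnS => le_ik ->; exists i.
case/deltaP: hu => i le_ik ->; case/deltaP: hv => j le_jk ->.
case/deltaP: ht => l le_lk -> {u v t}.
set A := [set m : 'I_k | (m < i)%N]; set B := [set m : 'I_k | (m < j)%N].
pose Q (s : 'S_k) := #|[set s m | m in A] :&: B| == l.
have -> : [set omega | random_discrete_copula pi (i%:R / k%:R) (j%:R / k%:R)
    omega = l%:R / k%:R :> R]%classic = [set omega | Q (pi omega)]%classic.
  by apply/seteqP; split=> w /=; rewrite /Q -(discrete_copula_eq R) // => /eqP.
rewrite uniform_permutation_prob //; congr (_%:E).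
have cA : #|A| = i by exact: card_ord_lt.
have cB : #|B| = j by exact: card_ord_lt.
have cAC : #|~: A| = (k - i)%N by rewrite cardsCs finset.setCK card_ord cA.
have cBC : #|~: B| = (k - j)%N by rewrite cardsCs finset.setCK card_ord cB.
have -> : k%:R * (i%:R / k%:R) = i%:R :> R by field.
have -> : k%:R * (j%:R / k%:R) = j%:R :> R by field.
have -> : k%:R * (l%:R / k%:R) = l%:R :> R by field.
have -> : k%:R * (1 - i%:R / k%:R) = (k - i)%:R :> R by rewrite natrB //; field.
have -> : k%:R * (1 - j%:R / k%:R) = (k - j)%:R :> R by rewrite natrB //; field.
have -> : k%:R * (i%:R / k%:R - l%:R / k%:R) = i%:R - l%:R :> R by field.
have -> : k%:R * (j%:R / k%:R - l%:R / k%:R) = j%:R - l%:R :> R by field.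
(* The sign is not yet known, hence a difference of two naturals, as [invfactr_natB] expects. *)
have -> : k%:R * (1 - i%:R / k%:R - j%:R / k%:R + l%:R / k%:R) =
    (k + l)%:R - (i + j)%:R :> R by rewrite !natrD; field.
rewrite !factr_nat !invfactr_natB !invfactr_nat.
have fact_neq0 n : (n`!)%:R != 0 :> R by rewrite pnatr_eq0 -lt0n fact_gt0.
(* If [i < l], no image of [A] has [l] points in [B], and 1/(i - l)! is 0. *)
have [le_li|lt_il] := leqP l i; last first.
  rewrite (_ : [set s | Q s] = finset.set0) ?cards0 ?(mul0r, mulr0) //.
  apply/setP => s; rewrite !inE; apply/negbTE; rewrite neq_ltn.
  rewrite (leq_ltn_trans (subset_leq_card (finset.subsetIl _ _))) //.
  by rewrite card_imset ?cA //; exact: perm_inj.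
rewrite (@card_perm_imsetI _ A B l (i - l)) ?subnKC ?cA //.
rewrite cAC cB cBC.
have [le_lj|lt_jl] := leqP l j; last first.
  by rewrite bin_small // !(mul0n, muln0, mul0r, mulr0).
(* If [k + l < i + j], then [k - j < i - l]: the second binomial vanishes, as does the matching
   inverse factorial. *)
have [le_ijkl|lt_klij] := leqP (i + j)%N (k + l)%N; last first.
  rewrite ['C(k - j, _)]bin_small ?(mul0n, muln0, mul0r, mulr0) //; lia.
(* All differences are now nonnegative; expanding [j]! and [(k - j)]! through the two binomials lets
   the factorials cancel. *)
rewrite -(bin_fact le_lj).
have le_b : (i - l <= k - j)%N by lia.
have -> : (k + l - (i + j) = k - j - (i - l))%N by lia.
rewrite -(bin_fact le_b).
rewrite !natrM; field.
by rewrite !fact_neq0.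
Qed.
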